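(* Let $s\in\mathbb{N}$ and let $\tilde E\in\mathbb{R}^{s\times s}$ be the matrix with entries $\tilde E_{i,i+1}=i$ for $1\le i\le s-1$ and all other entries zero. Let $X=(x_{ij})\in\mathbb{R}^{s\times s}$ be symmetric and suppose that $U=(u_{ij}):=X\tilde E+\tilde E^{\sf T}X$ is positive semi-definite. Then $u_{ij}=0$ whenever $\min\{i,j\}\le\lfloor(s+1)/2\rfloor$, and also $x_{ij}=0$ whenever $i+j\le s$. *)

(* Defs.v *)
From mathcomp Require Import all_boot all_order all_algebra.
From mathcomp Require Import reals.

Set Implicit Arguments.
Unset Strict Implicit.
Unset Printing Implicit Defensive.

Import Order.TTheory GRing.Theory Num.Theory.
Local Open Scope ring_scope.

(* Indices are 0-based: the mathematical row (column) number of i : 'I_s is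
   i.+1, so the 1-based entry E_{k,k+1} = k sits here at (k - 1, k). *)
Definition Etilde (R : realType) (s : nat) : 'M[R]_s :=
  \matrix_(i < s, j < s) (if j == i.+1 :> nat then i.+1%:R else 0).

Definition posSemidef (R : realType) (n : nat) (A : 'M[R]_n) : Prop :=
  A \is symmetricmx /\ forall v : 'cV[R]_n, 0 <= (v^T *m A *m v) 0 0.

(* Main.v *)
(** Indexing from 0, [U i j = j x_{i,j-1} + i x_{i-1,j}].  By induction on the
    row [m] with [2 m < s], the diagonal entry [U m m = 2 m x_{m-1,m}] vanishes
    by the previous row of [X], so positive semi-definiteness kills the whole
    row [m] of [U]; the vanishing of [U m (j+1)] together with that of
    [x_{m-1,j+1}] then gives [x_{m,j} = 0]. *)

Require Import Defs.
From mathcomp Require Import all_boot all_order all_algebra.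
From mathcomp Require Import reals.
From mathcomp Require Import zify ring lra.

Set Implicit Arguments.
Unset Strict Implicit.
Unset Printing Implicit Defensive.

Import Order.TTheory GRing.Theory Num.Theory.

Local Open Scope ring_scope.

Lemma symmetricmxE (R : fieldType) (n : nat) (A : 'M[R]_n) (i j : 'I_n) :
  A \is symmetricmx -> A i j = A j i.
Proof.
by move=> /is_hermitianmxP hA; rewrite {1}hA expr0 scale1r !mxE.
Qed.

Lemma mulmx_Etilde0 (R : realType) (s : nat) (X : 'M[R]_s) (i j : 'I_s) :
  j = 0%N :> nat -> (X *m Etilde R s) i j = 0.
Proof.
by move=> j0; rewrite mxE big1 // => k _; rewrite mxE j0 mulr0.
Qed.

Lemma mulmx_EtildeS (R : realType) (s : nat) (X : 'M[R]_s) (i j k : 'I_s) :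
  j = k.+1 :> nat -> (X *m Etilde R s) i j = X i k * k.+1%:R.
Proof.
move=> jk; rewrite mxE (bigD1 k) //= mxE jk eqxx big1 ?addr0 // => l lk.
rewrite mxE jk eqSS; case: eqP => [kl|_]; last by rewrite mulr0.
by rewrite -(inj_eq val_inj) /= kl eqxx in lk.
Qed.

(** Reduces all entries of [U] to entries of [X *m Etilde R s], since by symmetry its second summand
    is the transpose of the first. *)
Lemma trmx_Etilde_mul (R : realType) (s : nat) (X : 'M[R]_s) (i j : 'I_s) :
  X \is symmetricmx ->
  ((Etilde R s)^T *m X) i j = (X *m Etilde R s) j i.
Proof.
move=> hX; rewrite !mxE; apply: eq_bigr => k _.
by rewrite mxE mulrC (symmetricmxE k j hX).
Qed.

(** As [A i i = 0], the quadratic form at [t e_i + e_j] is affine in [t]; being nonnegative for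
    every [t], it has slope zero. *)
Lemma posSemidef_row0 (R : realType) (n : nat) (A : 'M[R]_n) (i j : 'I_n) :
  posSemidef A -> A i i = 0 -> A i j = 0.
Proof.
move=> [symA posA] Aii.
have entryE (k l : 'I_n) :
    (delta_mx 0 k *m A *m delta_mx l 0 : 'M[R]_1) 0 0 = A k l.
  by rewrite -rowE -colE !mxE.
have quad (t : R) : 0 <= t * A i j *+ 2 + A j j.
  have := posA (t *: delta_mx i 0 + delta_mx j 0).
  have -> : (t *: delta_mx i 0 + delta_mx j 0 : 'cV[R]_n)^T =
      t *: delta_mx 0 i + delta_mx 0 j.
    by rewrite linearD linearZ /= !trmx_delta.
  rewrite !mulmxDl !mulmxDr.
  have addE (B C : 'M[R]_1) : (B + C) 0 0 = B 0 0 + C 0 0 by rewrite mxE.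
  have scaleE (a : R) (B : 'M[R]_1) : (a *: B) 0 0 = a * B 0 0 by rewrite mxE.
  rewrite -!scalemxAl -!scalemxAr !addE !scaleE.
  by rewrite !entryE Aii (symmetricmxE j i) // !mulr0 add0r addrA -mulr2n.
apply/eqP; apply: contraT => Aij.
(* This [t] gives the affine function the value -1. *)
have := quad (- (A j j + 1) / (A i j *+ 2)).
have -> : - (A j j + 1) / (A i j *+ 2) * A i j *+ 2 = - (A j j + 1) by field.
by lra.
Qed.

Lemma Etilde_rows0 (R : realType) (s : nat) (X : 'M[R]_s) :
  X \is symmetricmx ->
  let U := X *m Etilde R s + (Etilde R s)^T *m X in
  posSemidef U ->
  forall (m : nat) (i : 'I_s), i = m :> nat -> (m.*2 < s)%N ->
    (forall j, U i j = 0) /\ (forall j : 'I_s, (i + j + 2 <= s)%N -> X i j = 0).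
Proof.
move=> hX U psdU.
have UE (i j : 'I_s) :
    U i j = (X *m Etilde R s) i j + (X *m Etilde R s) j i.
  by rewrite [U i j]mxE trmx_Etilde_mul.
elim=> [|m IHm] i im lt_m_s.
  have Urow j : U i j = 0.
    by apply: posSemidef_row0 => //; rewrite UE mulmx_Etilde0 ?addr0.
  (* The bound on [j] makes [j.+1] a legal column, where [U] has the entry [(j + 1) x_{0,j}]. *)
  split=> // j lt_ij_s; have lt_j_s : (j.+1 < s)%N by lia.
  have := Urow (Ordinal lt_j_s).
  rewrite UE (@mulmx_EtildeS _ _ _ _ _ j) // mulmx_Etilde0 // addr0 => /eqP.
  by rewrite mulf_eq0 pnatr_eq0 orbF => /eqP.
have lt_m : (m < s)%N by lia.
pose p := Ordinal lt_m.
have [_ Xp] : (forall j, U p j = 0) /\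
    (forall j : 'I_s, (p + j + 2 <= s)%N -> X p j = 0).
  by apply: IHm => //; lia.
(* Used twice: at row [i] it kills the diagonal entry of [U], at row [j.+1] it isolates [x_{i,j}] in
   [U i (j+1)]. *)
have XEi (j : 'I_s) : (p + j + 2 <= s)%N -> (X *m Etilde R s) j i = 0.
  move=> le_pj.
  by rewrite (@mulmx_EtildeS _ _ _ _ _ p) // (symmetricmxE j p) // Xp ?mul0r.
have Urow j : U i j = 0.
  by apply: posSemidef_row0 => //; rewrite UE XEi ?addr0 //= im; lia.
split=> // j lt_ij_s; have lt_j_s : (j.+1 < s)%N by lia.
have := Urow (Ordinal lt_j_s).
rewrite UE (@mulmx_EtildeS _ _ _ _ _ j) // XEi /= ?addr0; last by lia.
by move/eqP; rewrite mulf_eq0 pnatr_eq0 orbF => /eqP.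
Qed.

Theorem lemma3p3 (R : realType) (s : nat) (X : 'M[R]_s)
    (hX : X \is symmetricmx) :
  let U := X *m Etilde R s + (Etilde R s)^T *m X in
  posSemidef U ->
  (forall i j : 'I_s, (minn i.+1 j.+1 <= (s + 1) %/ 2)%N -> U i j = 0) /\
  (forall i j : 'I_s, (i.+1 + j.+1 <= s)%N -> X i j = 0).
Proof.
move=> U psdU.
have rows (i : 'I_s) (hi : (i.*2 < s)%N) := Etilde_rows0 hX psdU (erefl _) hi.
have symU := psdU.1.
split=> i j hij.
  (* For a 0-based index [k], [k + 1 <= (s + 1) %/ 2] means exactly [2 k < s]. *)
  have [hi|hj] : (i.*2 < s)%N \/ (j.*2 < s)%N by lia.
  - exact: (rows i hi).1.
  - by rewrite (symmetricmxE i j) //; exact: (rows j hj).1.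
(* The smaller of [i] and [j] has double at most [i + j < s]. *)
have [hi|hj] : (i.*2 < s)%N \/ (j.*2 < s)%N by lia.
- by apply: (rows i hi).2; lia.
- by rewrite (symmetricmxE i j) //; apply: (rows j hj).2; lia.
Qed.
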